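(* Let $\mathscr{A}$ be a connected cochain DG algebra over $k$ and let $P$ be a DG $\mathscr{A}$-module whose underlying graded module $P^{\#}$ is a finitely generated $\mathscr{A}^{\#}$-module. If $P$ is categorically projective, then $P$ is a categorically free DG $\mathscr{A}$-module.
   Context: $k$ is an algebraically closed field of characteristic $0$. A cochain DG algebra $\mathscr{A}$ is a $\mathbb{Z}$-graded $k$-algebra with a $k$-linear map $\partial_{\mathscr{A}}$ of degree $1$ such that $\partial_{\mathscr{A}}^2=0$ and $\partial_{\mathscr{A}}(ab)=\partial_{\mathscr{A}}(a)b+(-1)^{|a|}a\partial_{\mathscr{A}}(b)$ for homogeneous $a,b$. Its underlying graded algebra is $\mathscr{A}^{\#}$; $\mathscr{A}$ is connected if $\mathscr{A}^{\#}$ is a connected graded algebra, i.e. $\mathscr{A}^{i}=0$ for $i<0$ and $\mathscr{A}^0=k$. A DG $\mathscr{A}$-module is a complex $(M,\partial_M)$ (differential of degree $1$) which is a graded left $\mathscr{A}$-module with $\partial_M(am)=\partial_{\mathscr{A}}(a)m+(-1)^{|a|}a\partial_M(m)$; $M^{\#}$ is its underlying graded $\mathscr{A}^{\#}$-module. An $\mathscr{A}$-homomorphism $f:M\to N$ of degree $i$ is a $k$-linear map of degree $i$ with $f(am)=(-1)^{i|a|}af(m)$; $\mathrm{Hom}_{\mathscr{A}}(M,N)$ is the complex of all such, with differential $f\mapsto \partial_N\circ f-(-1)^{|f|}f\circ\partial_M$. A DG morphism is a degree $0$ $\mathscr{A}$-homomorphism commuting with the differentials; it is a quasi-isomorphism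 if it induces an isomorphism on cohomology. A DG $\mathscr{A}$-module $P$ is categorically projective if $\mathrm{Hom}_{\mathscr{A}}(P,-)$ turns surjective DG morphisms into surjective quasi-isomorphisms. A subset $Y$ of homogeneous elements of a DG $\mathscr{A}$-module $F$ is categorically free if for each DG $\mathscr{A}$-module $N$ and each homogeneous map $g:Y\to N$ of degree $0$ there is a unique DG morphism $f:F\to N$ with $f|_Y=g$. A DG $\mathscr{A}$-module $F$ is categorically free if there is a categorically free subset $Y\subset F$ such that $F=\bigoplus_{y\in Y}[\mathscr{A}y\oplus\mathscr{A}\partial_F(y)]$. *)

(* Defs.v *)
From mathcomp Require Import all_boot all_order all_algebra.

Set Implicit Arguments.
Unset Strict Implicit.
Unset Printing Implicit Defensive.

Import GRing.Theory.
Local Open Scope ring_scope.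

(* [V] is the internal direct sum of the additive subgroups [S i], for the
   indices [i] satisfying [D]: every element is a finite sum of elements of
   distinct [S i], and the [S i] are independent. *)
Definition direct_sum (I : eqType) (V : zmodType)
    (D : I -> Prop) (S : I -> V -> Prop) : Prop :=
  (forall x : V, exists s : seq I, exists u : I -> V,
      [/\ uniq s, forall i, i \in s -> D i /\ S i (u i)
        & x = \sum_(i <- s) u i])
  /\ (forall (s : seq I) (u : I -> V), uniq s ->
      (forall i, i \in s -> D i /\ S i (u i)) ->
      \sum_(i <- s) u i = 0 -> forall i, i \in s -> u i = 0).

(* A module over a [k]-algebra [A] is a [k]-vector space through [c%:A];
   a graded object is represented by its total space together with the
   subspaces [gr i] of homogeneous elements of degree [i]. *)
Definition is_grading (k : fieldType) (A : algType k) (M : lmodType A)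
    (gr : int -> M -> Prop) : Prop :=
  (forall i, gr i 0 /\
     forall (c : k) x y, gr i x -> gr i y -> gr i (c%:A *: x + y))
  /\ direct_sum (fun _ : int => True) gr.

Definition klinear (k : fieldType) (A : algType k) (M N : lmodType A)
    (f : M -> N) : Prop :=
  forall (c : k) x y, f (c%:A *: x + y) = c%:A *: f x + f y.

(* The sign (-1)^i, which only depends on the parity of [`|i|]. *)
Definition sgnz (R : nzRingType) (i : int) : R := (-1) ^+ `|i|%N.

Record dgAlgebra (k : fieldType) := DGAlgebra {
  dga_car :> algType k;
  dga_gr : int -> dga_car -> Prop;
  dga_d : dga_car -> dga_car;
  dga_grading : @is_grading k dga_car dga_car^o dga_gr;
  dga_gr1 : dga_gr 0 1;
  dga_grM : forall i j a b, dga_gr i a -> dga_gr j b -> dga_gr (i + j) (a * b);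
  dga_d_linear : @klinear k dga_car dga_car^o dga_car^o dga_d;
  dga_d_deg : forall i a, dga_gr i a -> dga_gr (i + 1) (dga_d a);
  dga_dd : forall a, dga_d (dga_d a) = 0;
  dga_leibniz : forall i j a b, dga_gr i a -> dga_gr j b ->
    dga_d (a * b) = dga_d a * b + sgnz dga_car i * a * dga_d b
}.

Definition connected (k : fieldType) (A : dgAlgebra k) : Prop :=
  (forall i a, i < 0 -> dga_gr i a -> a = 0 :> A)
  /\ (forall a : A, dga_gr 0 a <-> exists c : k, a = c%:A).

Record dgModule (k : fieldType) (A : dgAlgebra k) := DGModule {
  dgm_car :> lmodType A;
  dgm_gr : int -> dgm_car -> Prop;
  dgm_d : dgm_car -> dgm_car;
  dgm_grading : @is_grading k A dgm_car dgm_gr;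
  dgm_grZ : forall i j (a : A) x,
    dga_gr i a -> dgm_gr j x -> dgm_gr (i + j) (a *: x);
  dgm_d_linear : @klinear k A dgm_car dgm_car dgm_d;
  dgm_d_deg : forall i x, dgm_gr i x -> dgm_gr (i + 1) (dgm_d x);
  dgm_dd : forall x, dgm_d (dgm_d x) = 0;
  dgm_leibniz : forall i j (a : A) x, dga_gr i a -> dgm_gr j x ->
    dgm_d (a *: x) = dga_d a *: x + sgnz A i *: (a *: dgm_d x)
}.

Definition finitely_generated (R : nzRingType) (M : lmodType R) : Prop :=
  exists (n : nat) (g : 'I_n -> M), forall x : M,
    exists c : 'I_n -> R, x = \sum_(i < n) c i *: g i.

Section Hom.
Variables (k : fieldType) (A : dgAlgebra k).

(* [f] is an element of degree [i] of Hom_A(M, N). *)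
Definition dg_hom (M N : dgModule A) (i : int) (f : M -> N) : Prop :=
  [/\ @klinear k A M N f,
      forall j x, dgm_gr j x -> dgm_gr (j + i) (f x)
    & forall j (a : A) x, dga_gr j a -> f (a *: x) = sgnz A (i * j) *: (a *: f x)].

(* The differential of Hom_A(M, N) on the elements of degree [i]. *)
Definition hom_d (M N : dgModule A) (i : int) (f : M -> N) : M -> N :=
  fun x => dgm_d (f x) - sgnz A i *: f (dgm_d x).

Definition hom_cocycle (M N : dgModule A) (i : int) (f : M -> N) : Prop :=
  dg_hom i f /\ hom_d i f =1 (fun=> 0).

Definition hom_coboundary (M N : dgModule A) (i : int) (f : M -> N) : Prop :=
  exists2 h : M -> N, dg_hom (i - 1) h & f =1 hom_d (i - 1) h.

Definition dg_morphism (M N : dgModule A) (f : M -> N) : Prop :=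
  dg_hom 0 f /\ forall x, f (dgm_d x) = dgm_d (f x).

Definition surj (T U : Type) (f : T -> U) : Prop :=
  forall y, exists x, f x = y.

(* Hom_A(P, f) : Hom_A(P, M) -> Hom_A(P, N) is surjective in each degree. *)
Definition Hom_surjective (P M N : dgModule A) (f : M -> N) : Prop :=
  forall (i : int) (h : P -> N), dg_hom i h ->
    exists2 g : P -> M, dg_hom i g & f \o g =1 h.

(* Hom_A(P, f) induces in each degree an injective and surjective map on
   cohomology, i.e. on cocycles modulo coboundaries. *)
Definition Hom_quasi_iso (P M N : dgModule A) (f : M -> N) : Prop :=
  forall i : int,
    (forall g : P -> M, hom_cocycle i g ->
       hom_coboundary i (f \o g) -> hom_coboundary i g)
    /\ (forall h : P -> N, hom_cocycle i h ->
       exists2 g : P -> M, hom_cocycle i g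
                         & hom_coboundary i (fun x => h x - f (g x))).

Definition categorically_projective (P : dgModule A) : Prop :=
  forall (M N : dgModule A) (f : M -> N), dg_morphism f -> surj f ->
    Hom_surjective P f /\ Hom_quasi_iso P f.

(* A map on the subset [Y] is given by a map on [F], of which only the values
   on [Y] matter. *)
Definition categorically_free_subset (F : dgModule A) (Y : F -> Prop) : Prop :=
  (forall y, Y y -> exists i, dgm_gr i y)
  /\ forall (N : dgModule A) (g : F -> N),
       (forall i y, Y y -> dgm_gr i y -> dgm_gr i (g y)) ->
       (exists f : F -> N, dg_morphism f /\ forall y, Y y -> f y = g y)
       /\ (forall f f' : F -> N,
             dg_morphism f -> (forall y, Y y -> f y = g y) ->
             dg_morphism f' -> (forall y, Y y -> f' y = g y) -> f =1 f').

(* The summand of index [(y, false)] is A y, that of index [(y, true)] is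
   A d(y). *)
Definition categorically_free (F : dgModule A) : Prop :=
  exists2 Y : F -> Prop, categorically_free_subset Y
    & direct_sum (fun p : F * bool => Y p.1)
        (fun p (x : F) => exists a : A,
           x = a *: (if p.2 then dgm_d p.1 else p.1)).

End Hom.

(* Main.v *)
(* Lifting along [P -> 0] shows that the identity of [P] is a coboundary, so
   there is a contraction [h] of degree -1 with [d h + h d = 1].  Then
   [x = d (h x) + h (d x)] shows that finitely many homogeneous [y i],
   together with the [d (y i)], generate [P]; take their number minimal.  Let
   [eps : A -> k] be the augmentation.  In a relation
   [sum (a i) (y i) + sum (b i) d (y i) = 0], minimality gives
   [eps (a i) = 0].  So the functional [phi i] sending an element to [eps] of
   its coefficient at [y i] is well defined; it vanishes on boundaries, hence
   [phi i (h (d (y j))) = phi i (y j)], and applying [phi i] after [h] to the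
   relation gives [eps (b i) = 0].  Finally, the coordinate functionals
   [P -> k] lift along [eps] to [P -> A], and their values on the generators
   form a unitriangular matrix for the order by degree, so the generators are
   free over [A]. *)
Require Import Defs.
From HB Require Import structures.
From mathcomp Require Import all_boot all_order all_algebra.
From mathcomp Require Import boolp.

Set Implicit Arguments.
Unset Strict Implicit.
Unset Printing Implicit Defensive.

Import Order.TTheory GRing.Theory Num.Theory.
Local Open Scope ring_scope.

(** * Homogeneous components in a graded module *)

Section Grading.
Variables (k : fieldType) (A : algType k) (M : lmodType A).
Variable gr : int -> M -> Prop.
Hypothesis gradingP : @is_grading k A M gr.

Lemma gr0 i : gr i 0. Proof. by case: (gradingP.1 i). Qed.

Lemma gr_klin i (c : k) x y : gr i x -> gr i y -> gr i (c%:A *: x + y).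
Proof. by case: (gradingP.1 i) => _; apply. Qed.

Lemma grD i x y : gr i x -> gr i y -> gr i (x + y).
Proof. by move=> xi yi; have := gr_klin 1 xi yi; rewrite !scale1r. Qed.

Lemma gr_sum i (I : finType) (F : I -> M) :
  (forall j, gr i (F j)) -> gr i (\sum_j F j).
Proof. by move=> Fi; elim/big_ind: _ => // [|x y]; [exact: gr0 | exact: grD]. Qed.

(** A family over all degrees with finite support, unlike the lists of [direct_sum]: two
    decompositions can then be added and compared degree by degree. *)
Definition decomposition (x : M) (u : int -> M) : Prop :=
  (forall i, gr i (u i)) /\
  exists s : seq int, [/\ uniq s, forall i, i \notin s -> u i = 0
                        & x = \sum_(i <- s) u i].

Lemma sum_supp (s t : seq int) (u : int -> M) :
  uniq s -> uniq t -> {subset s <= t} -> (forall i, i \notin s -> u i = 0) ->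
  \sum_(i <- t) u i = \sum_(i <- s) u i.
Proof.
move=> us ut st u0; rewrite (bigID (mem s)) /= [X in _ + X]big1 ?addr0; last first.
  by move=> i; exact: u0.
rewrite -big_filter; apply: perm_big; apply: uniq_perm => // [|i].
  exact: filter_uniq.
rewrite mem_filter; apply/andP/idP => [[]//|si]; split=> //; exact: st.
Qed.

Lemma decomposition_exists x : exists u, decomposition x u.
Proof.
case: gradingP.2 => /(_ x)[s [u [us su xE]]] _.
exists (fun i => if i \in s then u i else 0); split=> [i|].
  by case: ifP => [/su[]//|_]; exact: gr0.
exists s; split=> // [i /negbTE->//|]; rewrite xE.
by apply: eq_big_seq => i ->.
Qed.

Lemma decomposition_klin (c : k) x y u v :
  decomposition x u -> decomposition y v ->
  decomposition (c%:A *: x + y) (fun i => c%:A *: u i + v i).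
Proof.
move=> [ugr [s [us s0 ->]]] [vgr [t [ut t0 ->]]]; split=> [i|].
  exact: gr_klin.
have ust := undup_uniq (s ++ t).
exists (undup (s ++ t)); split=> // [i|].
  by rewrite mem_undup mem_cat negb_or => /andP[/s0-> /t0->]; rewrite scaler0 addr0.
rewrite big_split /= -scaler_sumr.
rewrite (sum_supp us ust) // => [|i si]; last by rewrite mem_undup mem_cat si.
by rewrite (sum_supp ut ust) // => i si; rewrite mem_undup mem_cat si orbT.
Qed.

Lemma decomposition0 u : decomposition 0 u -> forall i, u i = 0.
Proof.
move=> [ugr [s [us s0 /esym su]]] i; case: (boolP (i \in s)) => [|/s0//].
by apply: gradingP.2.2 us _ su i => j.
Qed.

Lemma decomposition_uniq x u v :
  decomposition x u -> decomposition x v -> forall i, u i = v i.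
Proof.
move=> xu xv i; have := decomposition_klin (-1) xv xu.
rewrite scaleN1r scaleN1r addNr => /decomposition0/(_ i).
by rewrite scaleN1r addrC => /subr0_eq.
Qed.

(** By [decomposition_uniq] the result does not depend on the decomposition chosen, which yields
    [k]-linearity. *)
Definition component (i : int) (x : M) : M :=
  projT1 (cid (decomposition_exists x)) i.

Lemma component_decomposition x : decomposition x (component^~ x).
Proof. by rewrite /component; case: cid. Qed.

Lemma component_gr i x : gr i (component i x).
Proof. by case: (component_decomposition x). Qed.

Lemma component_klin i (c : k) x y :
  component i (c%:A *: x + y) = c%:A *: component i x + component i y.
Proof.
have := decomposition_klin c (component_decomposition x)
  (component_decomposition y).
by move/(decomposition_uniq (component_decomposition _)).
Qed.

Lemma componentD i x y : component i (x + y) = component i x + component i y.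
Proof. by have := component_klin i 1 x y; rewrite !scale1r. Qed.

Lemma component_id i j x : gr j x -> component i x = if i == j then x else 0.
Proof.
move=> xj; rewrite -[RHS]/((fun l => if l == j then x else 0) i).
apply: decomposition_uniq (component_decomposition x) _ i; split=> [i|].
  by case: eqP => [->//|_]; exact: gr0.
exists [:: j]; split=> // [i|]; first by rewrite inE => /negbTE->.
by rewrite big_seq1 eqxx.
Qed.

Lemma component0 i : component i 0 = 0.
Proof. by rewrite (component_id i (gr0 0)) if_same. Qed.

Lemma component_sum i (I : finType) (F : I -> M) :
  component i (\sum_j F j) = \sum_j component i (F j).
Proof.
apply: (big_morph (component i)); [exact: componentD | exact: component0].
Qed.

Lemma sum_components x :
  exists s : seq int, x = \sum_(i <- s) component i x.
Proof. by have [_ [s [_ _ xs]]] := component_decomposition x; exists s. Qed.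

(** Serves to extend identities derived from the Leibniz and sign rules, which concern homogeneous
    elements only, to all elements. *)
Lemma homogeneous_ind (Q : M -> Prop) :
  Q 0 -> (forall x y, Q x -> Q y -> Q (x + y)) ->
  (forall i x, gr i x -> Q x) -> forall x, Q x.
Proof.
move=> Q0 QD Qgr x; have [s ->] := sum_components x.
by elim/big_ind: _ => // i _; exact: Qgr (component_gr i x).
Qed.

Lemma component_inj x : (forall i, component i x = 0) -> x = 0.
Proof. by move=> x0; have [s ->] := sum_components x; rewrite big1. Qed.

End Grading.

(** * DG modules, their homomorphisms, and the contraction of a projective *)

Section Algebra.
Variables (k : fieldType) (A : dgAlgebra k).
Implicit Types (a b : A).

Definition acomponent (i : int) (a : A) : A := component (dga_grading A) i a.

Lemma kmulE (c : k) a : (c%:A : A) *: (a : A^o) = c *: a.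
Proof. by rewrite -[LHS]/(c%:A * a) mulr_algl. Qed.

Lemma dgaD a b : dga_d (a + b) = dga_d a + dga_d b.
Proof. by have := dga_d_linear (d := A) 1 a b; rewrite !scale1r. Qed.

Lemma dga0 : dga_d (0 : A) = 0.
Proof. by apply: (addrI (dga_d 0)); rewrite -dgaD !addr0. Qed.

Lemma acomponent_gr i a : dga_gr i (acomponent i a).
Proof. exact: component_gr. Qed.

Lemma acomponentD i a b : acomponent i (a + b) = acomponent i a + acomponent i b.
Proof. exact: (componentD (dga_grading A)). Qed.

Lemma acomponent_id i j a :
  dga_gr j a -> acomponent i a = if i == j then a else 0.
Proof. exact: (component_id (dga_grading A)). Qed.

Lemma acomponent0 i : acomponent i 0 = 0.
Proof. exact: (component0 (dga_grading A)). Qed.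

Lemma acomponentZ i (c : k) a : acomponent i (c *: a) = c *: acomponent i a.
Proof.
have := component_klin (dga_grading A) i c a 0.
by rewrite (component0 (dga_grading A)) !addr0 !kmulE.
Qed.

Lemma acomponent_inj a : (forall i, acomponent i a = 0) -> a = 0.
Proof. exact: (@component_inj k A A^o _ (dga_grading A) a). Qed.

Lemma alg_homogeneous_ind (Q : A -> Prop) :
  Q 0 -> (forall a b, Q a -> Q b -> Q (a + b)) ->
  (forall i a, dga_gr i a -> Q a) -> forall a, Q a.
Proof. exact: (homogeneous_ind (dga_grading A)). Qed.

Section Module.
Variable P : dgModule A.
Implicit Types (x y : P).

Definition mcomponent (i : int) (x : P) : P := component (dgm_grading P) i x.

Lemma dgmD x y : dgm_d (x + y) = dgm_d x + dgm_d y.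
Proof. by have := dgm_d_linear (d := P) 1 x y; rewrite !scale1r. Qed.

Lemma dgm0 : dgm_d (0 : P) = 0.
Proof. by apply: (addrI (dgm_d 0)); rewrite -dgmD !addr0. Qed.

Lemma dgm_sum (I : finType) (F : I -> P) :
  dgm_d (\sum_i F i) = \sum_i dgm_d (F i).
Proof. by apply: (big_morph (@dgm_d _ _ P)); [exact: dgmD | exact: dgm0]. Qed.

Lemma mcomponent_scale t e a x :
  dgm_gr e x -> mcomponent t (a *: x) = acomponent (t - e) a *: x.
Proof.
move=> xe; elim/alg_homogeneous_ind: a => [|a b IHa IHb|i a ai].
- by rewrite acomponent0 !scale0r /mcomponent component0.
- by rewrite acomponentD !scalerDl /mcomponent componentD -IHa -IHb.
- rewrite /mcomponent (component_id _ _ (dgm_grZ ai xe)) (acomponent_id _ ai).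
  by rewrite subr_eq; case: ifP; rewrite ?scale0r.
Qed.

(** For homogeneous [a] the Leibniz rule writes [d (a x)] as an [A]-combination of [x] and [d x]. *)
Lemma dgm_d_scale_closed (U : P -> Prop) e x :
  U 0 -> (forall a u v, U u -> U v -> U (a *: u + v)) ->
  dgm_gr e x -> U x -> U (dgm_d x) -> forall a, U (dgm_d (a *: x)).
Proof.
move=> U0 Ulin xe Ux Udx; elim/alg_homogeneous_ind => [|a b Ua Ub|i a ai].
- by rewrite scale0r dgm0.
- by rewrite scalerDl dgmD -[dgm_d (a *: x)]scale1r; exact: Ulin.
- rewrite (dgm_leibniz ai xe) scalerA.
  by rewrite addrC; apply: (Ulin) => //; rewrite -[X in U X]addr0; exact: Ulin.
Qed.

End Module.

Section Homomorphism.
Variables (P N : dgModule A) (i : int) (f : P -> N).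
Hypothesis f_hom : dg_hom i f.

Lemma dg_homD x y : f (x + y) = f x + f y.
Proof. by case: f_hom => /(_ 1 x y); rewrite !scale1r. Qed.

Lemma dg_hom0 : f 0 = 0.
Proof. by apply: (addrI (f 0)); rewrite -dg_homD !addr0. Qed.

Lemma dg_hom_sum (I : finType) (F : I -> P) : f (\sum_j F j) = \sum_j f (F j).
Proof. by apply: (big_morph f); [exact: dg_homD | exact: dg_hom0]. Qed.

End Homomorphism.

Lemma dg_morphism_linear (P N : dgModule A) (f : P -> N) :
  dg_morphism f -> forall a x, f (a *: x) = a *: f x.
Proof.
move=> [fh _] a x; elim/alg_homogeneous_ind: a => [|a b IHa IHb|i a ai].
- by rewrite !scale0r (dg_hom0 fh).
- by rewrite !scalerDl (dg_homD fh) IHa IHb.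
- by case: fh => _ _ /(_ _ _ x ai)->; rewrite mul0r scale1r.
Qed.

Lemma regular_leibniz i j (a : A) (x : A^o) : dga_gr i a -> dga_gr j x ->
  dga_d (a *: x) = dga_d a *: x + sgnz A i *: (a *: (dga_d x : A^o)) :> A^o.
Proof. by move=> ai xj; rewrite [LHS](dga_leibniz ai xj) -mulrA. Qed.

Definition regular_dgm : dgModule A :=
  @DGModule k A A^o (@dga_gr _ A) (@dga_d _ A) (dga_grading A) (@dga_grM _ A)
    (@dga_d_linear _ A) (@dga_d_deg _ A) (@dga_dd _ A) regular_leibniz.

(** Row vectors of length 0 are the carrier: [thinmx0] makes them all equal to 0. *)
Definition zero_dgm : dgModule A.
Proof.
apply: (@DGModule k A 'rV[A]_0 (fun _ _ => True) (fun=> 0)) => //.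
- split=> [//|]; split=> [x|s u _ _ _ i _]; last by rewrite [u i]thinmx0.
  by exists [::], (fun=> 0); split=> //; rewrite big_nil [x]thinmx0.
- by move=> c x y; rewrite scaler0 addr0.
- by move=> i j a x _ _; rewrite [x]thinmx0 !scaler0 addr0.
Defined.

Lemma categorically_projective_contractible (P : dgModule A) :
  categorically_projective P ->
  exists2 h : P -> P, dg_hom (-1) h & forall x, x = dgm_d (h x) + h (dgm_d x).
Proof.
move=> P_proj; pose f := (fun=> 0) : P -> zero_dgm.
have f_mor : dg_morphism f.
  split=> [|//]; split=> // [c x y|j a x _]; first by rewrite scaler0 addr0.
  by rewrite !scaler0.
have f_surj : surj f by move=> y; exists 0; rewrite [y]thinmx0.
have id_hom : dg_hom 0 (id : P -> P).
  split=> // [j x|j a x _]; first by rewrite addr0.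
  by rewrite mul0r scale1r.
(* The identity is a cocycle of degree 0 with zero image in Hom(P, 0), so injectivity on cohomology
   makes it a coboundary; the sign in degree -1 turns [hom_d] into [d h + h d]. *)
have [|//|h h_hom hE] := ((P_proj _ _ f f_mor f_surj).2 0).1 id.
- by split=> // x; rewrite /hom_d scale1r subrr.
- exists (fun=> 0) => [|x]; last by rewrite /hom_d scaler0 subr0.
  by split=> // [c x y|j a x _]; rewrite !scaler0 ?addr0.
- by exists h => // x; rewrite {1}[x]hE /hom_d scaleN1r opprK.
Qed.

End Algebra.

(** * The augmentation and the residue field as a DG module *)

Section Connected.
Variables (k : fieldType) (A : dgAlgebra k) (A_connected : connected A).
Implicit Types (a b : A).

Lemma scalar_inj (c d : k) : c%:A = d%:A :> A -> c = d.
Proof.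
move=> /eqP; rewrite -subr_eq0 -scalerBl scaler_eq0 oner_eq0 orbF subr_eq0.
by move/eqP.
Qed.

Lemma acomponent_degree0 a : exists c : k, acomponent 0 a = c%:A.
Proof. by apply/A_connected.2; exact: acomponent_gr. Qed.

Definition augmentation (a : A) : k := projT1 (cid (acomponent_degree0 a)).

Lemma augmentationE a : acomponent 0 a = (augmentation a)%:A.
Proof. by rewrite /augmentation; case: cid. Qed.

Lemma augmentation_eq0 i a : dga_gr i a -> i != 0 -> augmentation a = 0.
Proof.
move=> ai i0; apply: scalar_inj; rewrite -augmentationE (acomponent_id _ ai).
by rewrite eq_sym (negbTE i0) scale0r.
Qed.

Lemma scalar_gr0 (c : k) : dga_gr 0 (c%:A : A).
Proof. by apply/A_connected.2; exists c. Qed.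

Lemma augmentation_scalar (c : k) : augmentation c%:A = c.
Proof.
by apply: scalar_inj; rewrite -augmentationE (acomponent_id _ (scalar_gr0 c)) eqxx.
Qed.

Lemma augmentation0 : augmentation 0 = 0.
Proof. by have := augmentation_scalar 0; rewrite scale0r. Qed.

Lemma augmentation1 : augmentation 1 = 1.
Proof. by have := augmentation_scalar 1; rewrite scale1r. Qed.

Lemma augmentationD a b : augmentation (a + b) = augmentation a + augmentation b.
Proof.
by apply: scalar_inj; rewrite scalerDl -!augmentationE acomponentD.
Qed.

Lemma augmentationN a : augmentation (- a) = - augmentation a.
Proof.
by apply: (addrI (augmentation a)); rewrite -augmentationD !subrr augmentation0.
Qed.

Lemma gr_lt0 i a : dga_gr i a -> i < 0 -> a = 0.
Proof. by move=> ai i0; exact: A_connected.1 i0 ai. Qed.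

Lemma gr0_scalar a : dga_gr 0 a -> a = (augmentation a)%:A.
Proof. by move=> a0; rewrite -augmentationE (acomponent_id _ a0) eqxx. Qed.

(** As [A] has no negative degrees, a nonzero product of homogeneous elements has degree 0 only if
    both factors do. *)
Lemma augmentationM a b : augmentation (a * b) = augmentation a * augmentation b.
Proof.
elim/alg_homogeneous_ind: a => [|a a' IHa IHb|i a ai].
- by rewrite mul0r augmentation0 mul0r.
- by rewrite mulrDl !augmentationD IHa IHb mulrDl.
elim/alg_homogeneous_ind: b => [|b b' IHa IHb|j b bj].
- by rewrite mulr0 augmentation0 mulr0.
- by rewrite mulrDr !augmentationD IHa IHb mulrDr.
have [i0|i0|i0] := ltgtP i 0.
- by rewrite (gr_lt0 ai i0) mul0r augmentation0 mul0r.
- have [j0|j0] := ltP j 0.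
    by rewrite (gr_lt0 bj j0) mulr0 augmentation0 mulr0.
  rewrite (augmentation_eq0 (dga_grM ai bj)) ?(augmentation_eq0 ai) ?mul0r //.
    by rewrite gt_eqF.
  by rewrite gt_eqF // ltr_wpDr.
- have a0 : dga_gr 0 a by rewrite -i0.
  rewrite [a in LHS]gr0_scalar // mulr_algl; apply: scalar_inj.
  by rewrite -augmentationE acomponentZ augmentationE scalerA.
Qed.

(** A boundary has no component of degree 0, because [A] vanishes in degree -1. *)
Lemma augmentation_d a : augmentation (dga_d a) = 0.
Proof.
elim/alg_homogeneous_ind: a => [|a b IHa IHb|i a ai].
- by rewrite dga0 augmentation0.
- by rewrite dgaD augmentationD IHa IHb addr0.
have [i0|i0] := ltP i 0; first by rewrite (gr_lt0 ai i0) dga0 augmentation0.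
by rewrite (augmentation_eq0 (dga_d_deg ai)) // gt_eqF // ltr_wpDl.
Qed.

(** An alias of [k] that records the connectedness proof, so that the inferred [A]-module structure
    can go through the augmentation. *)
Definition residue of connected A : Type := k.
HB.instance Definition _ := GRing.Zmodule.copy (residue A_connected) k.

Definition residue_scale (a : A) (v : residue A_connected) : residue A_connected :=
  augmentation a * v.

Lemma residue_scaleA a b v :
  residue_scale a (residue_scale b v) = residue_scale (a * b) v.
Proof. by rewrite /residue_scale augmentationM mulrA. Qed.

Lemma residue_scale1 : left_id 1 residue_scale.
Proof. by move=> v; rewrite /residue_scale augmentation1 mul1r. Qed.

Lemma residue_scaleDr : right_distributive residue_scale +%R.
Proof. by move=> a u v; exact: mulrDr. Qed.

Lemma residue_scaleDl v : {morph residue_scale^~ v : a b / a + b}.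
Proof. by move=> a b; rewrite /residue_scale augmentationD; exact: mulrDl. Qed.

HB.instance Definition _ := GRing.Zmodule_isLmodule.Build A (residue A_connected)
  residue_scaleA residue_scale1 residue_scaleDr residue_scaleDl.

Definition residue_gr (i : int) (v : residue A_connected) : Prop := i = 0 \/ v = 0.

Definition residue_dgm : dgModule A.
Proof.
apply: (@DGModule k A (residue A_connected) residue_gr (fun=> 0)).
- split=> [i|].
    split=> [|c x y [i0|->] [i1|->]]; by [left|right; rewrite ?scaler0 ?addr0].
  split=> [x|s u us su].
    exists [:: 0], (fun=> x); split=> // [i|]; last by rewrite big_seq1.
    by rewrite inE => /eqP->; split=> //; left.
  have u0 i : i \in s -> i != 0 -> u i = 0.
    by move=> /su[_ [->|//]]; rewrite eqxx.
  move=> sum0 i si; have [i0|/u0->//] := eqVneq i 0; move: sum0.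
  rewrite (big_rem i) //= big1_seq ?addr0 // => j /andP[_].
  rewrite mem_rem_uniq // inE => /andP[/= ji js]; apply: u0 => //.
  by rewrite -i0.
- move=> i j a x ai [->|->]; last by right; rewrite scaler0.
  have [->|i0] := eqVneq i 0; first by left.
  by right; rewrite -[LHS]/(augmentation a * x) (augmentation_eq0 ai i0) mul0r.
- by move=> c x y; rewrite scaler0 addr0.
- by move=> i x _; right.
- by [].
- move=> i j a x _ _; rewrite !scaler0 addr0.
  by rewrite -[RHS]/(augmentation (dga_d a) * x) augmentation_d mul0r.
Defined.

Definition residue_map : regular_dgm A -> residue_dgm := augmentation.

Lemma residue_map_morphism : dg_morphism residue_map.
Proof.
split; first split.
- move=> c x y; rewrite /residue_map augmentationD; congr +%R.
  by rewrite -[LHS]/(augmentation (c%:A * x)) augmentationM.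
- move=> j x xj; rewrite addr0; have [->|j0] := eqVneq j 0; first by left.
  by right; exact: augmentation_eq0 j0.
- move=> j a x _; rewrite mul0r scale1r.
  by rewrite -[LHS]/(augmentation (a * x)) augmentationM.
- by move=> x; exact: augmentation_d.
Qed.

Lemma residue_map_surj : surj residue_map.
Proof. by move=> c; exists (c : k)%:A; exact: augmentation_scalar. Qed.

(* On the residue field the sign rule is void: homogeneous elements of nonzero
   degree act by zero. *)
Lemma dg_hom_residue (P : dgModule A) (e : int) (f : P -> residue_dgm) :
  (forall x y, f (x + y) = f x + f y) -> (forall a x, f (a *: x) = a *: f x) ->
  (forall j x, dgm_gr j x -> j + e != 0 -> f x = 0) -> dg_hom e f.
Proof.
move=> fD fZ f0; split=> [c x y|j x xj|j a x aj]; first by rewrite fD fZ.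
  have [->|je] := eqVneq (j + e) 0; first by left.
  by right; exact: f0 xj je.
rewrite fZ; have [->|j0] := eqVneq j 0; first by rewrite mulr0 scale1r.
suff -> : a *: f x = 0 by rewrite scaler0.
by rewrite -[LHS]/(augmentation a * f x) (augmentation_eq0 aj j0) mul0r.
Qed.

End Connected.

(** * Relations among homogeneous generators, and freeness by lifting functionals *)

Lemma delta_comb (R : nzRingType) (M : lmodType R) (Q : finType) (z : Q -> M) q :
  \sum_p (p == q)%:R *: z p = z q.
Proof.
rewrite (bigD1 q) //= eqxx scale1r big1 ?addr0 // => p /negbTE->.
by rewrite scale0r.
Qed.

Section Families.
Variables (k : fieldType) (A : dgAlgebra k) (A_connected : connected A).
Variables (P : dgModule A) (Q : finType) (z : Q -> P) (e : Q -> int).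
Hypothesis z_gr : forall q, dgm_gr (e q) (z q).
Local Notation eps := (augmentation A_connected).

Lemma mcomponent_comb t (a : Q -> A) :
  mcomponent t (\sum_q a q *: z q) = \sum_q acomponent (t - e q) (a q) *: z q.
Proof.
rewrite /mcomponent component_sum; apply: eq_bigr => q _.
exact: mcomponent_scale (z_gr q).
Qed.

Hypothesis z_gen : forall x, exists a : Q -> A, x = \sum_q a q *: z q.

(** Coefficients of an element are not unique, but two choices differ by a relation, whose
    coefficient at [q] has augmentation 0. The degree is [- e q] because the augmentation only sees
    a coefficient of degree 0. *)
Lemma coefficient_functional q :
  (forall a, \sum_p a p *: z p = 0 -> eps (a q) = 0) ->
  exists2 phi : P -> residue_dgm A_connected, dg_hom (- e q) phi
    & forall a, phi (\sum_p a p *: z p) = eps (a q).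
Proof.
move=> minimal_q; have [c cE] := choice z_gen.
pose phi x : residue_dgm A_connected := eps (c x q).
have phiE a : phi (\sum_p a p *: z p) = eps (a q).
  set x := \sum_p _; have := minimal_q (fun p => c x p - a p).
  rewrite augmentationD augmentationN => eq0; apply: subr0_eq; apply: eq0.
  rewrite -[RHS](subrr x) {2}[x]cE -sumrB.
  by apply: eq_bigr => p _; rewrite scalerBl.
exists phi => //; apply: dg_hom_residue => [x y|a x|j x xj jq].
- rewrite [x]cE [y]cE -big_split /=.
  under eq_bigr do rewrite -scalerDl.
  by rewrite !phiE augmentationD.
- rewrite [x]cE scaler_sumr; under eq_bigr do rewrite scalerA.
  by rewrite !phiE augmentationM.
- have -> : x = mcomponent j x by rewrite /mcomponent (component_id _ _ xj) eqxx.
  rewrite [x]cE mcomponent_comb phiE.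
  exact: augmentation_eq0 (acomponent_gr _ _) jq.
Qed.

(** The lift [psi] belonging to [q] has degree [- e q], so [psi (z p)] lies in degree [e p - e q]:
    it is 0 for [e p < e q] and a scalar, fixed by its augmentation, for [e p = e q]. *)
Lemma free_of_minimal :
  categorically_projective P ->
  (forall a, \sum_q a q *: z q = 0 -> forall q, eps (a q) = 0) ->
  forall a, \sum_q a q *: z q = 0 -> forall q, a q = 0.
Proof.
move=> P_proj minimal.
have lift q : exists2 psi : P -> regular_dgm A, dg_hom (- e q) psi
    & forall p, eps (psi (z p)) = (p == q)%:R.
  have [phi phi_hom phiE] := @coefficient_functional q (fun a a0 => minimal a a0 q).
  have [psi psi_hom psiE] := (P_proj _ _ _ (@residue_map_morphism _ _ A_connected)
    (@residue_map_surj _ _ A_connected)).1 _ _ phi_hom.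
  exists psi => // p; have -> : eps (psi (z p)) = phi (z p) by exact: psiE.
  rewrite -[z p]delta_comb phiE eq_sym; case: eqP => _; first exact: augmentation1.
  exact: augmentation0.
(* Applying the lift at an index of maximal degree among the nonzero
   homogeneous coefficients isolates that coefficient. *)
have homogeneous t a : (forall q, dga_gr (t - e q) (a q)) ->
    \sum_q a q *: z q = 0 -> forall q, a q = 0.
  move=> a_gr rel q0; apply: contrapT => /eqP aq0.
  case: (@Order.TotalTheory.arg_maxP _ _ _ q0 (fun q => a q != 0) e aq0) => q aq qmax.
  have [psi psi_hom psiE] := lift q.
  have [_ psi_gr psi_scale] := psi_hom.
  have : psi 0 = 0 by exact: dg_hom0 psi_hom.
  rewrite -[in psi _]rel (dg_hom_sum psi_hom) (bigD1 q) //= big1 => [|p pq].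
    have qq : psi (z q) = 1 :> A.
      have /gr0_scalar->: dga_gr 0 (psi (z q) : A).
        by have := psi_gr _ _ (z_gr q); rewrite subrr.
      by rewrite psiE eqxx scale1r.
    rewrite addr0 (psi_scale _ _ _ (a_gr q)) qq.
    rewrite -[LHS]/(sgnz A _ * (a q * 1)) mulr1 => s0.
    (* The sign is its own inverse, so [a q] itself would vanish, against the choice of [q]. *)
    move: aq; rewrite -(signrMK (absz (- e q * (t - e q))) (a q)).
    by rewrite [X in _ * X]s0 mulr0 eqxx.
  have [->|ap] := eqVneq (a p) 0; first by rewrite scale0r (dg_hom0 psi_hom).
  rewrite (psi_scale _ _ _ (a_gr p)); suff -> : psi (z p) = 0 by rewrite !scaler0.
  have zp := psi_gr _ _ (z_gr p).
  have : e p <= e q by exact: qmax.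
  rewrite le_eqVlt => /orP[/eqP epq|epq].
    have /gr0_scalar->: dga_gr 0 (psi (z p) : A).
      by move: zp; rewrite epq subrr.
    by rewrite psiE (negbTE pq) scale0r.
  by apply: gr_lt0 zp _ => //; rewrite subr_lt0.
(* The part of the relation in degree [i + e q] is the one whose coefficient at [q] is the component
   of degree [i]. *)
move=> a rel q; apply: acomponent_inj => i.
have := homogeneous (i + e q) (fun p => acomponent (i + e q - e p) (a p)).
move=> /(_ (fun p => acomponent_gr _ _)); rewrite -mcomponent_comb rel.
by rewrite /mcomponent component0 => /(_ erefl q); rewrite addrK.
Qed.

End Families.

(** * Generation by elements and their differentials, and minimal generating families *)

Section Contraction.
Variables (k : fieldType) (A : dgAlgebra k) (A_connected : connected A).
Local Notation eps := (augmentation A_connected).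

(** The sign rule of [f] becomes invisible in the residue field: scalars of nonzero degree act by 0
    there, and those of degree 0 carry no sign. *)
Lemma residue_hom_scale (M N : dgModule A) (e : int) (f : M -> N)
    (phi : N -> residue_dgm A_connected) : dg_hom e f ->
  (forall x y, phi (x + y) = phi x + phi y) ->
  (forall a x, phi (a *: x) = a *: phi x) ->
  forall a x, phi (f (a *: x)) = a *: phi (f x).
Proof.
move=> f_hom phiD phiZ a x.
have phi0 : phi 0 = 0 by apply: (addrI (phi 0)); rewrite -phiD !addr0.
elim/alg_homogeneous_ind: a => [|a b IHa IHb|i a ai].
- by rewrite !scale0r (dg_hom0 f_hom).
- by rewrite !scalerDl (dg_homD f_hom) phiD IHa IHb.
have [_ _ /(_ _ _ x ai)->] := f_hom; rewrite !phiZ.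
have [->|i0] := eqVneq i 0; first by rewrite mulr0 scale1r.
suff -> : a *: phi (f x) = 0 by rewrite scaler0.
by rewrite -[LHS]/(eps a * phi (f x)) (augmentation_eq0 _ ai i0) mul0r.
Qed.

Variables (P : dgModule A).

Definition submodule_closed (U : P -> Prop) : Prop :=
  U 0 /\ forall a u v, U u -> U v -> U (a *: u + v).

(** Generation of [P] by the [y i] and [d (y i)], stated through submodule predicates so that
    families can be compared without handling coefficients. *)
Definition dg_generates (I : Type) (y : I -> P) : Prop :=
  (forall i, exists e, dgm_gr e (y i)) /\
  forall U, submodule_closed U -> (forall i, U (y i) /\ U (dgm_d (y i))) ->
  forall x, U x.

Definition with_d (I : Type) (y : I -> P) (q : I * bool) : P :=
  if q.2 then dgm_d (y q.1) else y q.1.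

Definition with_d_degree (I : Type) (e : I -> int) (q : I * bool) : int :=
  if q.2 then e q.1 + 1 else e q.1.

Lemma with_d_gr (I : Type) (y : I -> P) (e : I -> int) :
  (forall i, dgm_gr (e i) (y i)) ->
  forall q, dgm_gr (with_d_degree e q) (with_d y q).
Proof. by move=> y_gr [i []]; [apply: dgm_d_deg|]; exact: y_gr. Qed.

Lemma dg_generates_comb (I : finType) (y : I -> P) : dg_generates y ->
  forall x, exists a : I * bool -> A, x = \sum_q a q *: with_d y q.
Proof.
move=> [_ gen]; apply: gen => [|i].
  split=> [|a u v [b ->] [c ->]].
    by exists (fun=> 0); rewrite big1 // => q _; rewrite scale0r.
  exists (fun q => a * b q + c q); rewrite scaler_sumr -big_split /=.
  by apply: eq_bigr => q _; rewrite scalerA scalerDl.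
by split; [exists (fun p => (p == (i, false))%:R) | exists (fun p => (p == (i, true))%:R)];
   rewrite delta_comb.
Qed.

(** The generators have finitely many homogeneous components in all. Each component [x] equals
    [d (h x) + h (d x)], so the elements [h x] and [h (d x)] form a suitable family. *)
Lemma dg_generates_finite (h : P -> P) : @finitely_generated A P ->
  dg_hom (-1) h -> (forall x, x = dgm_d (h x) + h (dgm_d x)) ->
  exists (I : finType) (y : I -> P), dg_generates y.
Proof.
move=> [n [g gE]] [_ h_gr _] hE.
have [s sE] := choice (fun i => sum_components (dgm_grading P) (g i)).
pose c (i : 'I_n) (j : 'I_(size (s i))) : P := mcomponent (s i)`_j (g i).
pose J := {i : 'I_n & 'I_(size (s i))}.
pose y (p : J * bool) : P :=
  let x := c (tag p.1) (tagged p.1) in h (if p.2 then dgm_d x else x).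
exists (J * bool)%type, y; split=> [[[i j] b]|U [U0 Ulin] Uy x].
  have cij : dgm_gr (s i)`_j (c i j) by exact: component_gr.
  case: b; last by eexists; apply: h_gr; exact: cij.
  by eexists; apply: h_gr; apply: dgm_d_deg; exact: cij.
have UD u v : U u -> U v -> U (u + v).
  by move=> Uu Uv; rewrite -[u]scale1r; exact: Ulin.
have UZ a u : U u -> U (a *: u) by move=> Uu; rewrite -[_ *: u]addr0; exact: Ulin.
have [b ->] := gE x; elim/big_ind: _ => // i _; apply: UZ.
rewrite sE (big_nth 0) big_mkord; elim/big_ind: _ => // j _.
rewrite [X in U X](hE (c i j)); apply: UD.
  exact: (Uy (existT _ i j, false)).2.
exact: (Uy (existT _ i j, true)).1.
Qed.

Lemma minimal_dg_generates (I : finType) (y : I -> P) : dg_generates y ->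
  exists (J : finType) (u : J -> P), dg_generates u /\
    forall (L : finType) (v : L -> P), dg_generates v -> (#|J| <= #|L|)%N.
Proof.
move: {2}#|I|.+1 (ltnSn #|I|) => n; elim: n I y => // n IHn I y In gen.
have [[L [v [gen_v vI]]]|no] :=
    pselect (exists (L : finType) (v : L -> P), dg_generates v /\ (#|L| < #|I|)%N).
  by apply: IHn gen_v; exact: leq_trans vI _.
exists I, y; split=> // L v gen_v; rewrite leqNgt; apply/negP => LI.
by apply: no; exists L, v.
Qed.

Section Minimal.
Variables (I : finType) (y : I -> P) (e : I -> int).
Hypothesis y_gr : forall i, dgm_gr (e i) (y i).
Hypothesis y_gen : dg_generates y.
Hypothesis y_min :
  forall (L : finType) (v : L -> P), dg_generates v -> (#|I| <= #|L|)%N.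

(* Otherwise the component of degree [e i] of the relation expresses [y i], and
   hence also its differential, through the other generators: [dgm_d (y i)]
   does not occur in it, as its coefficient has degree [-1]. *)
Lemma minimal_relation (a : I * bool -> A) i :
  \sum_q a q *: with_d y q = 0 -> eps (a (i, false)) = 0.
Proof.
move=> rel; apply: contrapT => /eqP c0; set c := eps _ in c0.
pose F q := acomponent (e i - with_d_degree e q) (a q) *: with_d y q.
have sumF : \sum_q F q = 0.
  rewrite -(mcomponent_comb (with_d_gr y_gr)) rel.
  exact: component0.
suff /y_min : dg_generates (fun j : {j | j != i} => y (val j)).
  rewrite card_sig -[X in (_ <= X)%N]/#|predC1 i| cardC1.
  have : (0 < #|I|)%N by apply/card_gt0P; exists i.
  by case: #|I| => // m _; rewrite ltnn.
split=> [j|U Usub Uy]; first by exists (e (val j)).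
apply: y_gen.2 => // j; have [U0 Ulin] := Usub.
have [->{j}|ji] := eqVneq j i; last exact: (Uy (exist _ j ji)).
(* Both [y i] and its differential have to be recovered. Closure of [V] under [k]-combinations
   suffices, since the coefficient of [y i] to be inverted is a scalar. *)
pose V x := U x /\ U (dgm_d x).
have V0 : V 0 by rewrite /V dgm0.
have Vlin (d : k) u v : V u -> V v -> V (d%:A *: u + v).
  by move=> [? ?] [? ?]; split; rewrite ?dgm_d_linear; exact: Ulin.
have VF q : q != (i, false) -> V (F q).
  have [qi|qi] := eqVneq q.1 i.
    case: q qi => [_ []] /= ->; last by rewrite eqxx.
    move=> _; rewrite /F /with_d_degree /= opprD addrA subrr add0r.
    by rewrite (A_connected.1 _ _ _ (acomponent_gr _ _)) // scale0r.
  move=> _; have Uz : U (with_d y q) /\ U (dgm_d (with_d y q)).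
    have [Uyq Udyq] := Uy (exist _ q.1 qi).
    by rewrite /with_d; case: q.2; rewrite ?dgm_dd.
  split; first by rewrite -[F q]addr0; apply: Ulin => //; exact: Uz.1.
  exact: dgm_d_scale_closed U0 Ulin (with_d_gr y_gr q) Uz.1 Uz.2 _.
have -> : y i = (- c^-1)%:A *: (\sum_(q | q != (i, false)) F q) + 0.
  move: sumF; rewrite (bigD1 (i, false)) //= {1}/F /with_d_degree /= subrr.
  rewrite (augmentationE A_connected) -/c => /eqP; rewrite addrC addr_eq0.
  move=> /eqP->; rewrite addr0 scalerN scalerA mulr_algl scalerA mulNr.
  by rewrite mulVf // scaleN1r scaleNr opprK scale1r.
apply: (Vlin) => //; elim/big_ind: _ => // u v Vu Vv.
by have := Vlin 1 _ _ Vu Vv; rewrite !scale1r.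
Qed.

Lemma minimal_relation_d (h : P -> P) (a : I * bool -> A) i :
  dg_hom (-1) h -> (forall x, x = dgm_d (h x) + h (dgm_d x)) ->
  \sum_q a q *: with_d y q = 0 -> eps (a (i, true)) = 0.
Proof.
move=> h_hom hE rel.
have gen := dg_generates_comb y_gen.
have [phi phi_hom phiE] := coefficient_functional (with_d_gr y_gr) gen
  (fun b => @minimal_relation b i).
have phiD := dg_homD phi_hom.
have phi0 := dg_hom0 phi_hom.
have phiZ : forall b x, phi (b *: x) = b *: phi x.
  by move=> b x; exact: (residue_hom_scale (phi := id) phi_hom).
have phi_z q : phi (with_d y q) = (q == (i, false))%:R :> k.
  rewrite -[with_d y q]delta_comb phiE eq_sym.
  by case: eqP => _; [exact: augmentation1 | exact: augmentation0].
have phi_dz q : phi (dgm_d (with_d y q)) = 0.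
  case: q => [j []]; first by rewrite /with_d /= dgm_dd.
  by apply: etrans (phi_z (j, true)) _; rewrite xpair_eqE andbF.
(* In [d (b z) = (d b) z + (-1)^|b| b (d z)], with [z] one of the generators, [d b] has augmentation
   0 and [phi] kills [d z]. *)
have phi_d x : phi (dgm_d x) = 0.
  have [b ->] := gen x; rewrite dgm_sum (dg_hom_sum phi_hom) big1 // => q _.
  elim/alg_homogeneous_ind: (b q) => [|u v IHu IHv|j u uj].
  - by rewrite scale0r dgm0.
  - by rewrite scalerDl dgmD phiD IHu IHv addr0.
  rewrite (dgm_leibniz uj (with_d_gr y_gr q)) phiD !phiZ phi_dz !scaler0 addr0.
  by rewrite -[LHS]/(eps (dga_d u) * _) augmentation_d mul0r.
have phi_hd x : phi (h (dgm_d x)) = phi x by rewrite [in RHS](hE x) phiD phi_d add0r.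
have : phi (h 0) = 0 by rewrite (dg_hom0 h_hom).
(* Under [phi \o h] each [d (y j)] goes to [phi (y j)], which is 1 for [j = i] and 0 otherwise; the
   terms in [y j] vanish by [minimal_relation]. *)
rewrite -rel (dg_hom_sum h_hom) (dg_hom_sum phi_hom).
under eq_bigr do rewrite (residue_hom_scale h_hom phiD phiZ).
rewrite (bigD1 (i, true)) //= phi_hd (phi_z (i, false)) eqxx.
rewrite -[X in X + _]/(eps (a (i, true)) * 1) mulr1 big1 ?addr0 //.
move=> [j []] /= ji; rewrite -[LHS]/(eps (a _) * phi (h _)).
  rewrite phi_hd (phi_z (j, false)); move: ji.
  by rewrite !xpair_eqE !andbT => /negbTE->; rewrite mulr0.
by rewrite minimal_relation // mul0r.
Qed.

End Minimal.

(** * From an [A]-basis of elements and differentials to a categorically free module *)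

Section Free.
Variables (I : finType) (y : I -> P) (e : I -> int).
Hypothesis y_gr : forall i, dgm_gr (e i) (y i).
Hypothesis y_gen : dg_generates y.
Hypothesis y_free :
  forall a : I * bool -> A, \sum_q a q *: with_d y q = 0 -> forall q, a q = 0.

Lemma comb_inj (a b : I * bool -> A) :
  \sum_q a q *: with_d y q = \sum_q b q *: with_d y q -> forall q, a q = b q.
Proof.
move=> ab q; apply: subr0_eq; apply: (y_free (a := fun q => a q - b q)).
rewrite -[RHS](subrr (\sum_q b q *: with_d y q)) -{1}ab -sumrB.
by apply: eq_bigr => p _; rewrite scalerBl.
Qed.

(** The definition of [categorically_free] uses a subset of [P]; injectivity lets its elements
    replace the indices in [I]. *)
Lemma free_family_inj : injective y.
Proof.
move=> i j yij; apply: contrapT => /eqP ij.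
have := @comb_inj (fun q => (q == (i, false))%:R) (fun q => (q == (j, false))%:R).
rewrite !delta_comb /with_d /= yij => /(_ erefl (i, false)).
rewrite eqxx xpair_eqE (negbTE ij) => /eqP.
by rewrite oner_eq0.
Qed.

(** Compatibility with [d] forces the value [d (g (y i))] at [d (y i)]; the [A]-linear extension
    from the basis is well defined because coefficients are unique. *)
Lemma free_extension (N : dgModule A) (g : P -> N) :
  (forall i, dgm_gr (e i) (g (y i))) ->
  exists f : P -> N, dg_morphism f /\ forall i, f (y i) = g (y i).
Proof.
move=> g_gr; have [c cE] := choice (dg_generates_comb y_gen).
pose G (q : I * bool) : N := if q.2 then dgm_d (g (y q.1)) else g (y q.1).
have G_gr q : dgm_gr (with_d_degree e q) (G q).
  by case: q => i []; [apply: dgm_d_deg|]; exact: g_gr.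
pose f x := \sum_q c x q *: G q.
have fE a : f (\sum_q a q *: with_d y q) = \sum_q a q *: G q.
  by apply: eq_bigr => q _; congr (_ *: _); apply: comb_inj; rewrite -cE.
have f_lin a x x' : f (a *: x + x') = a *: f x + f x'.
  rewrite {1}[x]cE {1}[x']cE scaler_sumr -big_split /=.
  under eq_bigr do rewrite scalerA -scalerDl.
  rewrite fE /f scaler_sumr -big_split /=; apply: eq_bigr => q _.
  by rewrite scalerDl scalerA.
have fD x x' : f (x + x') = f x + f x' by have := f_lin 1 x x'; rewrite !scale1r.
have f0 : f 0 = 0 by apply: (addrI (f 0)); rewrite -fD !addr0.
have fZ a x : f (a *: x) = a *: f x by have := f_lin a x 0; rewrite f0 !addr0.
have f_z q : f (with_d y q) = G q by rewrite -[with_d y q]delta_comb fE delta_comb.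
have f_dz q : f (dgm_d (with_d y q)) = dgm_d (G q).
  case: q => i []; first by rewrite /with_d /G /= !dgm_dd.
  exact: (f_z (i, true)).
exists f; split=> [|i]; last exact: (f_z (i, false)).
split; first split=> [a x x'|j x xj|j a x _].
- exact: f_lin.
(* Taking the component of degree [j] replaces the chosen coefficients, which may be inhomogeneous,
   by homogeneous ones. *)
- have -> : x = mcomponent j x by rewrite /mcomponent (component_id _ _ xj) eqxx.
  rewrite [x]cE (mcomponent_comb (with_d_gr y_gr)) fE addr0.
  apply: (gr_sum (dgm_grading N)) => q.
  by have := dgm_grZ (acomponent_gr (j - with_d_degree e q) (c x q)) (G_gr q); rewrite subrK.
- by rewrite mul0r scale1r fZ.
move=> x; have -> : f x = \sum_q c x q *: G q by [].
rewrite {1}[x]cE !dgm_sum (big_morph f fD f0).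
apply: eq_bigr => q _.
elim/alg_homogeneous_ind: (c x q) => [|u v IHu IHv|j u uj].
- by rewrite !scale0r !dgm0 f0.
- by rewrite !scalerDl !dgmD fD IHu IHv.
- rewrite (dgm_leibniz uj (with_d_gr y_gr q)) (dgm_leibniz uj (G_gr q)).
  by rewrite fD !fZ f_z f_dz.
Qed.

Lemma categorically_free_family : categorically_free P.
Proof.
exists (fun x => exists i, x = y i).
  split=> [_ [i ->]|N g g_gr]; first by exists (e i).
  split.
    have [|f [f_mor fE]] := @free_extension N g.
      by move=> i; apply: g_gr => //; exists i.
    by exists f; split=> // _ [i ->].
  move=> f f' f_mor fE f'_mor f'E x.
  have [a ->] := dg_generates_comb y_gen x.
  rewrite (dg_hom_sum f_mor.1) (dg_hom_sum f'_mor.1); apply: eq_bigr => [[i b] _].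
  rewrite !(dg_morphism_linear _) //; congr (_ *: _).
  have yi : f (y i) = f' (y i) by rewrite fE ?f'E //; exists i.
  by case: b; rewrite /with_d //= f_mor.2 f'_mor.2 yi.
pose key (q : I * bool) : P * bool := (y q.1, q.2).
have key_inj : injective key.
  by move=> [i b] [j b'] [/free_family_inj-> ->].
split=> [x|s u us su sum0].
  have [a ->] := dg_generates_comb y_gen x.
  exists (map key (enum {: I * bool})).
  (* The sum over the fibre of [key] stands for its partial inverse: a single term on the image, 0
     elsewhere. *)
  exists (fun p => \sum_(q | key q == p) a q *: with_d y q).
  have uE q : \sum_(q' | key q' == key q) a q' *: with_d y q' = a q *: with_d y q.
    by rewrite (big_pred1 q) // => q'; rewrite /= (inj_eq key_inj).
  split; first by rewrite map_inj_uniq // enum_uniq.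
  - move=> _ /mapP[q _ ->]; split; first by exists q.1.
    by rewrite uE; exists (a q).
  - by rewrite big_map big_enum; apply: eq_bigr => q _; rewrite uE.
have coef q : exists b : A, key q \in s -> u (key q) = b *: with_d y q.
  have [/su[_ [b bE]]|_] := boolP (key q \in s); first by exists b.
  by exists 0.
have [b bE] := choice coef.
pose t := [seq q <- enum {: I * bool} | key q \in s].
have st : perm_eq s (map key t).
  apply: uniq_perm => // [|p].
    by rewrite map_inj_uniq // filter_uniq // enum_uniq.
  apply/idP/mapP => [sp|[q]]; last by rewrite mem_filter => /andP[sq _] ->.
  have [[i yi] _] := su p sp; exists (i, p.2); last by case: p yi {sp} => ? ? /= ->.
  by rewrite mem_filter mem_enum andbT /key /= -yi; case: p sp {yi}.
(* Extended by zero outside [s], the coefficients form a relation over all of [I * bool], to which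
   freeness applies. *)
have b0 : forall q, (if key q \in s then b q else 0) = 0.
  apply: y_free; move: sum0; rewrite (perm_big _ st) /= big_map big_filter big_enum_cond /=.
  move=> sum0; rewrite -[RHS]sum0 [RHS]big_mkcond; apply: eq_bigr => q _.
  by case: ifP => [/bE->|_]; rewrite ?scale0r.
move=> p sp; have := sp; rewrite (perm_mem st) => /mapP[q _ pE].
move: sp; rewrite pE => sq; rewrite bE //.
by have := b0 q; rewrite sq => ->; rewrite scale0r.
Qed.

End Free.
End Contraction.

Theorem theorem2p9 (k : closedFieldType) (k_char0 : [pchar k] =i pred0)
    (A : dgAlgebra k) (A_connected : connected A)
    (P : dgModule A) (P_fg : @finitely_generated A P)
    (P_proj : categorically_projective P) :
  categorically_free P.
Proof.
have [h h_hom hE] := categorically_projective_contractible P_proj.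
have [I0 [y0 gen0]] := dg_generates_finite P_fg h_hom hE.
have [I [y [y_gen y_min]]] := minimal_dg_generates gen0.
have [e y_gr] := choice y_gen.1.
(* By [free_of_minimal], freeness reduces to the vanishing of augmentations in every relation, first
   at the [d (y i)], then at the [y i]. *)
apply: (categorically_free_family y_gr y_gen).
apply: (free_of_minimal (A_connected := A_connected) (with_d_gr y_gr)
  (dg_generates_comb y_gen) P_proj) => a rel [i []].
- exact: (minimal_relation_d A_connected y_gr y_gen y_min i h_hom hE rel).
- exact: (minimal_relation A_connected y_gr y_gen y_min i rel).
Qed.
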